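(* Let $\Gamma$ be a sequent, $\varphi$ a $\bigvee$-formula of finite depth, and $d$ a debate for $f_0,f_1,\Gamma,\varphi$. If $f_0$ is a winning strategy for Eloisa in $G(\Gamma,\neg\varphi)$ and $f_1$ is a winning strategy for Eloisa in $G(\Gamma,\varphi)$, then the cut strategy $f=\mathrm{cut}(f_0,f_1)$ is a winning strategy for Eloisa in $G(\Gamma)$.
   Context: Cut strategy: for a finite sequence $p$ of moves of $G(\Gamma)$, compute the final round $d_s$ of the debate $d(p)$ (if $d(p)$ is finite), with leading play $p_n$, and set $f(p)=f_{\iota(n)}(p_n)$. Infinitary formulas. Formulas (negation normal form) over a set of atoms: literals $p,\neg p$; for nonempty $I$, $\bigvee_{i\in I}\varphi_i$ ($\bigvee$-formulas) and $\bigwedge_{i\in I}\varphi_i$ ($\bigwedge$-formulas). Negation via De Morgan duality. A fixed set $S$ of literals contains exactly one of $p,\neg p$ per atom. A sequent is a finite set of formulas; $\Gamma,\varphi=\Gamma\cup\{\varphi\}$; $\Gamma$ is an axiom if $\Gamma\cap S\neq\emptyset$. Formula trees and depth. $T(\varphi)$ is the tree of nodes (finite sequences) of $\varphi$: the root $\langle\rangle$ carries $\varphi_{\langle\rangle}=\varphi$, and if $\varphi_\sigma=\bigvee_{i\in I}\psi_i$ or $\bigwedge_{i\in I}\psi_i$ then $\sigma i\in T(\varphi)$ with $\varphi_{\sigma i}=\psi_i$; literal nodes are leaves. $\bigvee$-nodes have positive, $\bigwedge$-nodes negative polarity, a non-root leaf has polarity opposite to its parent. $\mathrm{dt}(\langle\rangle)=0$,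 $\mathrm{dt}(\sigma i)=\mathrm{dt}(\sigma)$ if same polarity, $\mathrm{dt}(\sigma)+1$ otherwise. $\varphi$ has finite depth if these are bounded. Games. $G=(X,E,A,W)$: moves $X$; $E,A\subseteq X^{<\mathbb{N}}\times X$ (Eloisa's, Abelard's legal moves) with disjoint domains; $W\subseteq P_G$, $P_G$ the finite sequences of successively legal moves. For $f\colon X^{<\mathbb{N}}\to X$, $T(f)$ is the set of plays $a_1\cdots a_n$ with, for $i<n$, $a_1\cdots a_i\notin W$ and $a_{i+1}=f(a_1\cdots a_i)$ whenever $a_1\cdots a_i\in\mathrm{dom}(E)$. $f$ is a strategy for Eloisa if for all $p\in T(f)$: $p\in W$ implies no proper extension in $T(f)$; $p\notin W$, $p\in\mathrm{dom}(E)$ implies exactly one $a$ with $pa\in T(f)$; $p\notin W$, $p\in\mathrm{dom}(A)$ implies $pa\in T(f)$ for all $(p,a)\in A$. $f$ is winning if for every infinite sequence $a_1a_2\cdots$ of moves there is $n$ with $a_1\cdots a_n\in P_G$ and either $a_1\cdots a_n\in W$, or $a_1\cdots a_n\in\mathrm{dom}(E)$ and $a_{n+1}\neq f(a_1\cdots a_n)$, or $a_1\cdots a_n\in\mathrm{dom}(A)$ and $(a_1\cdots a_n,a_{n+1})\notin A$. Tait game $G(\Gamma)$: moves $(\ell,\psi)$, $\ell\in\{g,q,r\}$, $\psi$ a $\bigwedge$-formula if $\ell=q$; $\Gamma_n=\Gamma\cup\{\psi\mid(\ell,\psi)\in\{a_1,\dots,a_n\}\}$; Eloisa moves at $a_1\cdots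 a_n$ when $n=0$ or $a_n\neq(q,\cdot)$, playing $(g,\psi_j)$ for some $\bigvee_j\psi_j\in\Gamma_n$ or $(q,\psi)$ with $\psi\in\Gamma_n$; after $a_n=(q,\bigwedge_j\psi_j)$ Abelard plays $(r,\psi_j)$ for some $j$; $W$: plays with $\Gamma_n$ an axiom. Interaction sequences: pointer sequences $i_0i_1\cdots$ ($i_0=0$, $i_{n+1}<n+1$) with $i_{n+1}\in V(n+1)$, where $V(0)=\emptyset$, $V(n+1)=\{n\}\cup V(i_n)$. Debates. $\iota(n)$ is the parity of $n$; $X$ is the set of moves of $G(\Gamma)$; $f_0$ is a strategy for Eloisa in $G(\Gamma,\neg\varphi)$ and $f_1$ in $G(\Gamma,\varphi)$. A quasi-debate $d$ assigns to every finite or infinite sequence $p=a_1a_2\cdots$ over $X$ a finite or infinite sequence $(d_0,\dot p_0)(d_1,\dot p_1)\cdots$ where each $d_s$ has the form $(p_0,\sigma_0,i_0)\cdots(p_{n-1},\sigma_{n-1},i_{n-1})\,p_n$ ($p_n$ the leading play) such that for all $m\le n$: (1) $p_m\in T(f_{\iota(m)})$; (2) $\sigma_m\in T(\varphi)$ for $m<n$; (3) $i_0\cdots i_{n-1}$ is an interaction sequence with $p_{i_m}$ a proper initial segment of $p_{m+1}$ and $\mathrm{dt}(\sigma_{i_m})<\mathrm{dt}(\sigma_m)$ for $0<m<n$; and for each $s$: (4) $\dot p_s$ is an initial segment of $p$ and a play in $G(\Gamma)$; (5) whenever defined, $d_{s+1}\neq d_s$ extends $d_s$ (it begins with the triples of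 $d_s$ followed by a play extending $p_n$) and $\dot p_s\subseteq\dot p_{s+1}$. $d$ is monotone if $q\subseteq p$ implies $d(q)$ is an initial segment of $d(p)$. $d$ is non-losing if for every $s$: $d(p)$ is finite of length $s+1$ iff, writing $\dot p_s=a_1\cdots a_l$, one of: (a) $\dot p_s\in W$; (b) $\dot p_s$ and $p_n$ are in the domains of Eloisa's moves, $a=f_{\iota(n)}(p_n)$ is a legal move in $G(\Gamma)$ at $\dot p_s$, and either $p=a_1\cdots a_l$ or $a_{l+1}$ exists and $a\ne a_{l+1}$; (c) $\dot p_s\in\mathrm{dom}(A)$ and either $p=a_1\cdots a_l$ or $a_{l+1}$ is not a legal move in $G(\Gamma)$. A debate for $f_0,f_1,\Gamma,\varphi$ is a non-losing monotone quasi-debate.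
   Formalization: The formal theorem also assumes the debate records moves: if round s is followed by another, and Eloisa is to move in both ṗ_s and p_n with a=f_{ι(n)}(p_n) legal in G(Γ) at ṗ_s, then ṗ_s a is an initial segment of ṗ_{s+1}. Without this the claim fails. *)

(* Defs.v *)
From Stdlib Require Import List Arith Ensembles Finite_sets.
Import ListNotations.

Set Implicit Arguments.
Unset Strict Implicit.
Unset Printing Implicit Defensive.

Inductive literal (At : Type) : Type :=
| pos (p : At)
| neg (p : At).

Inductive formula (At : Type) : Type :=
| Lit (l : literal At)
| Or (I : Type) (ne : inhabited I) (F : I -> formula At)
| And (I : Type) (ne : inhabited I) (F : I -> formula At).

Definition lit_dual At (l : literal At) : literal At :=
  match l with pos p => neg p | neg p => pos p end.

Fixpoint dual At (phi : formula At) : formula At :=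
  match phi with
  | Lit l => Lit (lit_dual l)
  | Or ne F => And ne (fun i => dual (F i))
  | And ne F => Or ne (fun i => dual (F i))
  end.

Definition is_or At (phi : formula At) : bool :=
  match phi with Or _ _ => true | _ => false end.

Definition is_and At (phi : formula At) : bool :=
  match phi with And _ _ => true | _ => false end.

Definition choice_of_literals At (S : Ensemble (literal At)) : Prop :=
  forall p, (S (pos p) /\ ~ S (neg p)) \/ (~ S (pos p) /\ S (neg p)).

Definition axiomatic At (S : Ensemble (literal At))
    (Gamma : Ensemble (formula At)) : Prop :=
  exists l, S l /\ Gamma (Lit l).

(** [node phi psi] is the type of the nodes sigma of T(phi) with
    phi_sigma = psi. *)
Inductive node At (phi : formula At) : formula At -> Type :=
| root : node phi phi
| or_child I (ne : inhabited I) (F : I -> formula At) :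
    node phi (Or ne F) -> forall i, node phi (F i)
| and_child I (ne : inhabited I) (F : I -> formula At) :
    node phi (And ne F) -> forall i, node phi (F i).

(** Polarity ([true] is positive) of a non-root node carrying [psi] whose
    parent has polarity [b]. *)
Definition polarity At (b : bool) (psi : formula At) : bool :=
  match psi with Lit _ => negb b | Or _ _ => true | And _ _ => false end.

Fixpoint node_dt At (phi psi : formula At) (sigma : node phi psi) : nat :=
  match sigma with
  | root _ => 0
  | @or_child _ _ _ _ F tau i =>
      if Bool.eqb (polarity true (F i)) true then node_dt tau
      else S (node_dt tau)
  | @and_child _ _ _ _ F tau i =>
      if Bool.eqb (polarity false (F i)) false then node_dt tau
      else S (node_dt tau)
  end.

Definition tree At (phi : formula At) : Type := {psi : formula At & node phi psi}.

Definition tree_root At (phi : formula At) : tree phi :=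
  existT (node phi) phi (root phi).

Definition dt At (phi : formula At) (sigma : tree phi) : nat :=
  node_dt (projT2 sigma).

Definition finite_depth At (phi : formula At) : Prop :=
  exists N, forall sigma : tree phi, dt sigma <= N.

Definition initial X (q p : list X) : Prop := exists r, p = q ++ r.

Definition proper_initial X (q p : list X) : Prop :=
  exists a r, p = q ++ a :: r.

Inductive sequence (X : Type) : Type :=
| fin (l : list X)
| inf (u : nat -> X).

Definition entry X (p : sequence X) (k : nat) : option X :=
  match p with fin l => nth_error l k | inf u => Some (u k) end.

Definition initial_seq X (q p : sequence X) : Prop :=
  forall k a, entry q k = Some a -> entry p k = Some a.

Definition has_length X (p : sequence X) (n : nat) : Prop :=
  exists l, p = fin l /\ length l = n.

Definition dom X (R : list X -> X -> Prop) (p : list X) : Prop :=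
  exists a, R p a.

Inductive legal_play X (E A : list X -> X -> Prop) : list X -> Prop :=
| legal_nil : legal_play E A []
| legal_snoc p a :
    legal_play E A p -> E p a \/ A p a -> legal_play E A (p ++ [a]).

Record game (X : Type) : Type := Game {
  eloisa : list X -> X -> Prop;
  abelard : list X -> X -> Prop;
  win : list X -> Prop;
  dom_disjoint : forall p, ~ (dom eloisa p /\ dom abelard p);
  win_play : forall p, win p -> legal_play eloisa abelard p
}.

Definition play X (G : game X) : list X -> Prop :=
  legal_play (eloisa G) (abelard G).

Definition legal X (G : game X) (p : list X) (a : X) : Prop :=
  eloisa G p a \/ abelard G p a.

Definition strategy_tree X (G : game X) (f : list X -> X) (p : list X) : Prop :=
  play G p /\
  forall q a r, p = q ++ a :: r ->
    ~ win G q /\ (dom (eloisa G) q -> a = f q).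

Definition strategy X (G : game X) (f : list X -> X) : Prop :=
  forall p, strategy_tree G f p ->
    (win G p -> forall q, proper_initial p q -> ~ strategy_tree G f q) /\
    (~ win G p -> dom (eloisa G) p ->
       exists! a, strategy_tree G f (p ++ [a])) /\
    (~ win G p -> dom (abelard G) p ->
       forall a, abelard G p a -> strategy_tree G f (p ++ [a])).

Definition take X (u : nat -> X) (n : nat) : list X := map u (seq 0 n).

Definition winning X (G : game X) (f : list X -> X) : Prop :=
  forall u : nat -> X, exists n,
    play G (take u n) /\
    (win G (take u n) \/
     (dom (eloisa G) (take u n) /\ u n <> f (take u n)) \/
     (dom (abelard G) (take u n) /\ ~ abelard G (take u n) (u n))).

Definition winning_strategy X (G : game X) (f : list X -> X) : Prop :=
  strategy G f /\ winning G f.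

Inductive label : Set := lab_g | lab_q | lab_r.

Definition move_ok At (l : label) (psi : formula At) : bool :=
  match l with lab_q => is_and psi | _ => true end.

Record move (At : Type) : Type := Move {
  mv_label : label;
  mv_formula : formula At;
  mv_ok : move_ok mv_label mv_formula = true
}.

Definition after At (Gamma : Ensemble (formula At)) (p : list (move At)) :
    Ensemble (formula At) :=
  fun psi => Gamma psi \/ exists a, List.In a p /\ mv_formula a = psi.

Definition tait_eloisa At (Gamma : Ensemble (formula At))
    (p : list (move At)) (a : move At) : Prop :=
  (forall q b, p = q ++ [b] -> mv_label b <> lab_q) /\
  ((mv_label a = lab_g /\
    exists (J : Type) (ne : inhabited J) (F : J -> formula At) (j : J),
      after Gamma p (Or ne F) /\ mv_formula a = F j) \/
   (mv_label a = lab_q /\ after Gamma p (mv_formula a))).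

Definition tait_abelard At (p : list (move At)) (a : move At) : Prop :=
  exists q b, p = q ++ [b] /\ mv_label b = lab_q /\
    mv_label a = lab_r /\
    exists (J : Type) (ne : inhabited J) (F : J -> formula At) (j : J),
      mv_formula b = And ne F /\ mv_formula a = F j.

Definition tait_win At (S : Ensemble (literal At))
    (Gamma : Ensemble (formula At)) (p : list (move At)) : Prop :=
  legal_play (tait_eloisa Gamma) (@tait_abelard At) p /\
  axiomatic S (after Gamma p).

Lemma tait_dom_disjoint At (Gamma : Ensemble (formula At)) p :
  ~ (dom (tait_eloisa Gamma) p /\ dom (@tait_abelard At) p).
Proof.
  intros [[a [He _]] [a' (q & b & Hp & Hb & _)]]. exact (He q b Hp Hb).
Qed.

Lemma tait_win_play At (S : Ensemble (literal At))
    (Gamma : Ensemble (formula At)) p :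
  tait_win S Gamma p -> legal_play (tait_eloisa Gamma) (@tait_abelard At) p.
Proof. intros [H _]; exact H. Qed.

Definition tait_game At (S : Ensemble (literal At))
    (Gamma : Ensemble (formula At)) : game (move At) :=
  Game (@tait_dom_disjoint At Gamma) (@tait_win_play At S Gamma).

(** [view i n k] says that k belongs to V(n); V(0) is empty. *)
Inductive view (i : nat -> nat) : nat -> nat -> Prop :=
| view_last n : view i (S n) n
| view_jump n k : view i (i n) k -> view i (S n) k.

Definition interaction (is : list nat) : Prop :=
  let i n := nth n is 0 in
  (0 < length is -> i 0 = 0) /\
  forall n, S n < length is -> i (S n) < S n /\ view i (S n) (i (S n)).

(** The state (p_0,sigma_0,i_0)...(p_(n-1),sigma_(n-1),i_(n-1)) p_n of a
    debate.  The default values in the accessors below are never reached by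
    the indices at which they are used. *)
Record state At (phi : formula At) : Type := State {
  triples : list (list (move At) * tree phi * nat);
  leading : list (move At)
}.

Definition st_size At (phi : formula At) (d : state phi) : nat :=
  length (triples d).

Definition st_play At (phi : formula At) (d : state phi) (m : nat) :
    list (move At) :=
  nth m (map (fun t => fst (fst t)) (triples d) ++ [leading d]) [].

Definition st_node At (phi : formula At) (d : state phi) (m : nat) : tree phi :=
  nth m (map (fun t => snd (fst t)) (triples d)) (tree_root phi).

Definition st_pointers At (phi : formula At) (d : state phi) : list nat :=
  map snd (triples d).

Definition st_pointer At (phi : formula At) (d : state phi) (m : nat) : nat :=
  nth m (st_pointers d) 0.

Definition state_extends At (phi : formula At) (d d' : state phi) : Prop :=
  (exists ts, triples d' = triples d ++ ts) /\
  initial (leading d) (st_play d' (st_size d)).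

Definition side_game At (S : Ensemble (literal At))
    (Gamma : Ensemble (formula At)) (phi : formula At) (n : nat) :
    game (move At) :=
  if Nat.even n then tait_game S (Add _ Gamma (dual phi))
  else tait_game S (Add _ Gamma phi).

Definition side_strategy At (f0 f1 : list (move At) -> move At) (n : nat) :
    list (move At) -> move At :=
  if Nat.even n then f0 else f1.

Definition debate_map At (phi : formula At) : Type :=
  sequence (move At) -> sequence (state phi * list (move At)).

Definition state_ok At (S : Ensemble (literal At)) f0 f1
    (Gamma : Ensemble (formula At)) (phi : formula At) (d : state phi) : Prop :=
  (forall m, m <= st_size d ->
     strategy_tree (side_game S Gamma phi m) (side_strategy f0 f1 m)
       (st_play d m)) /\
  interaction (st_pointers d) /\
  (forall m, 0 < m < st_size d ->
     proper_initial (st_play d (st_pointer d m)) (st_play d (m + 1)) /\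
     dt (st_node d (st_pointer d m)) < dt (st_node d m)).

(** The sequence of rounds is nonempty: there is always a round 0. *)
Definition quasi_debate At (S : Ensemble (literal At)) f0 f1
    (Gamma : Ensemble (formula At)) (phi : formula At) (d : debate_map phi) :
    Prop :=
  forall p,
    (exists r, entry (d p) 0 = Some r) /\
    (forall s ds ps, entry (d p) s = Some (ds, ps) ->
       state_ok S f0 f1 Gamma ds /\
       initial_seq (fin ps) p /\ play (tait_game S Gamma) ps) /\
    (forall s ds ps ds' ps',
       entry (d p) s = Some (ds, ps) -> entry (d p) (s + 1) = Some (ds', ps') ->
       ds' <> ds /\ state_extends ds ds' /\ initial ps ps').

Definition monotone At (phi : formula At) (d : debate_map phi) : Prop :=
  forall q p, initial_seq q p -> initial_seq (d q) (d p).

Definition proposed_move At f0 f1 (phi : formula At) (ds : state phi) : move At :=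
  side_strategy f0 f1 (st_size ds) (leading ds).

(** In the round (ds, ps) Eloisa is to move both in G(Gamma) and in the leading
    play, and the move that she makes in the latter is legal in G(Gamma). *)
Definition eloisa_round At (S : Ensemble (literal At)) f0 f1
    (Gamma : Ensemble (formula At)) (phi : formula At)
    (ds : state phi) (ps : list (move At)) : Prop :=
  dom (eloisa (tait_game S Gamma)) ps /\
  dom (eloisa (side_game S Gamma phi (st_size ds))) (leading ds) /\
  legal (tait_game S Gamma) ps (proposed_move f0 f1 ds).

Definition final_round At (S : Ensemble (literal At)) f0 f1
    (Gamma : Ensemble (formula At)) (phi : formula At) (p : sequence (move At))
    (ds : state phi) (ps : list (move At)) : Prop :=
  win (tait_game S Gamma) ps \/
  (eloisa_round S f0 f1 Gamma ds ps /\
   (p = fin ps \/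
    exists b, entry p (length ps) = Some b /\ proposed_move f0 f1 ds <> b)) \/
  (dom (abelard (tait_game S Gamma)) ps /\
   (p = fin ps \/
    exists b, entry p (length ps) = Some b /\ ~ legal (tait_game S Gamma) ps b)).

Definition non_losing At (S : Ensemble (literal At)) f0 f1
    (Gamma : Ensemble (formula At)) (phi : formula At) (d : debate_map phi) :
    Prop :=
  forall p s ds ps, entry (d p) s = Some (ds, ps) ->
    (has_length (d p) (s + 1) <-> final_round S f0 f1 Gamma p ds ps).

Definition debate At (S : Ensemble (literal At)) f0 f1
    (Gamma : Ensemble (formula At)) (phi : formula At) (d : debate_map phi) :
    Prop :=
  quasi_debate S f0 f1 Gamma d /\ monotone d /\ non_losing S f0 f1 Gamma d.

(** A debate that goes on after a round in which Eloisa proposes a move [a]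
    legal in G(Gamma) has read [a] as the next move of [p]; this move must then
    be recorded in the G(Gamma)-component of the following round.  Being a
    debate does not imply this: with [a] read but not recorded, a debate can
    stop in a later round whose proposed move differs from [a], although the
    cut strategy did play [a]. *)
Definition records_moves At (S : Ensemble (literal At)) f0 f1
    (Gamma : Ensemble (formula At)) (phi : formula At) (d : debate_map phi) :
    Prop :=
  forall p s ds ps ds' ps',
    entry (d p) s = Some (ds, ps) -> entry (d p) (s + 1) = Some (ds', ps') ->
    eloisa_round S f0 f1 Gamma ds ps ->
    initial (ps ++ [proposed_move f0 f1 ds]) ps'.

(** The value of the cut strategy is left unspecified at those p for which
    d(p) is infinite. *)
Definition is_cut At f0 f1 (phi : formula At) (d : debate_map phi)
    (f : list (move At) -> move At) : Prop :=
  forall p rs ds ps, d (fin p) = fin (rs ++ [(ds, ps)]) ->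
    f p = proposed_move f0 f1 ds.

(* Main.v *)
(* An infinite debate yields an infinite play of one of the winning strategies
   [f0] and [f1]: either the number of triples is eventually constant, and the
   leading plays grow forever, or there is an infinite interaction sequence [i]
   whose depth function is bounded and decreases along pointers.  In the latter
   case, induction on the bound gives an infinite chain for the relation
   "n + 1 extends i n": a position [m] of maximal depth is never pointed to, so
   that the segment from [i m] to [m] can be deleted.  Hence all debates are
   finite.  By monotonicity, the final round on [p] with G(Gamma)-play [ps] is
   also the final round on [ps], so that the cut strategy makes the move proposed
   there; the non-losing condition then gives legality and winning. *)

From Stdlib Require Import List Arith Lia Classical IndefiniteDescription.
Require Import Defs.
From Stdlib Require Import Ensembles Finite_sets.
Import ListNotations.

(** An inaccessible element has an inaccessible [R]-successor, so dependent choice would build a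
    chain. Here [Acc] descends along [R]-successors. *)
Lemma Acc_of_no_chain (A : Type) (R : A -> A -> Prop) :
  ~ (exists c : nat -> A, forall k, R (c k) (c (S k))) ->
  forall x, Acc (fun y x => R x y) x.
Proof.
  intros Hno x. apply NNPP. intro Hx.
  set (N := {y | ~ Acc (fun y x => R x y) y}).
  assert (Hstep : forall y : N, exists z : N, R (proj1_sig y) (proj1_sig z)).
  { intros [y Hy]; cbn. apply NNPP. intro H. apply Hy. constructor.
    intros z Hz. apply NNPP. intro Hz'. apply H.
    exists (exist _ z Hz'). exact Hz. }
  destruct (functional_choice _ Hstep) as [g Hg].
  apply Hno.
  exists (fun k => proj1_sig (Nat.iter k g (exist _ x Hx))).
  intro k. exact (Hg _).
Qed.

(** * Interaction sequences *)

Section Interaction.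

Variable i : nat -> nat.
Hypothesis i0 : i 0 = 0.
Hypothesis i_view : forall n, view i (S n) (i (S n)).

Lemma view_0 k : ~ view i 0 k.
Proof. intro H. inversion H. Qed.

Lemma view_S n k : view i (S n) k -> k = n \/ view i (i n) k.
Proof. intro H. inversion H; auto. Qed.

Lemma view_lt n : forall k, view i n k -> k < n.
Proof.
  induction n as [n IH] using lt_wf_ind. intros k Hk.
  destruct n as [|n]; [destruct (view_0 _ Hk)|].
  destruct (view_S _ _ Hk) as [->|H]; [lia|].
  destruct n as [|n]; [rewrite i0 in H; destruct (view_0 _ H)|].
  assert (H1 := IH (S n) (Nat.lt_succ_diag_r _) _ (i_view n)).
  assert (H2 := IH (i (S n)) ltac:(lia) _ H). lia.
Qed.

Lemma pointer_lt n : 0 < n -> i n < n.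
Proof. destruct n; [lia|]. intros _. apply view_lt. apply i_view. Qed.

Lemma pointer_le n : i n <= n.
Proof. destruct n; [rewrite i0; lia|]. assert (H := pointer_lt (S n)). lia. Qed.

(** For positive [n], [i n] is visible from [n], so by induction it has the parity of [S n]; jumping
    to its view therefore preserves the claim. *)
Lemma view_parity n : forall k, view i n k -> Nat.even n = negb (Nat.even k).
Proof.
  induction n as [n IH] using lt_wf_ind. intros k Hk.
  destruct n as [|n]; [destruct (view_0 _ Hk)|].
  destruct (view_S _ _ Hk) as [->|H].
  { now rewrite Nat.even_succ, <- Nat.negb_even. }
  destruct n as [|n]; [rewrite i0 in H; destruct (view_0 _ H)|].
  rewrite Nat.even_succ, <- Nat.negb_even, (IH (S n) ltac:(lia) _ (i_view n)).
  assert (Hlt := pointer_lt (S n)).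
  rewrite (IH (i (S n)) ltac:(lia) _ H). now destruct (Nat.even k).
Qed.

(** This puts the plays numbered [i n] and [S n] in the same side game. *)
Lemma pointer_parity n : 0 < n -> Nat.even (i n) = Nat.even (S n).
Proof.
  destruct n as [|n]; [lia|]. intros _.
  rewrite (Nat.even_succ (S n)), <- Nat.negb_even, (view_parity _ _ (i_view n)).
  now destruct (Nat.even _).
Qed.

(** * Depth along pointers and the deletion of segments of maximal depth *)

Variable D : nat -> nat.
Variable N : nat.
Hypothesis D_pointer : forall n, 0 < n -> D (i n) < D n.
Hypothesis D_max : forall n, 0 < n -> D n <= N.

Definition top (m : nat) : Prop := 0 < m /\ D m = N.

Lemma not_pointer_to_top n : 0 < n -> ~ top (i n).
Proof.
  intros Hn [H1 H2]. assert (H3 := D_pointer n Hn).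
  assert (H4 := D_max n Hn). lia.
Qed.

(* As nothing points to [m], the segment from [i m] to [m - 1] is never visible
   again. *)
Lemma top_hides m : top m ->
  forall n, m < n -> forall k, view i n k -> i m <= k <= m -> k = m.
Proof.
  intros Hm n. induction n as [n IH] using lt_wf_ind. intros Hn k Hk Hkm.
  destruct n as [|n]; [lia|].
  destruct (view_S _ _ Hk) as [->|H]; [lia|].
  assert (Hk' := view_lt _ _ H).
  destruct (Nat.eq_dec n m) as [->|Hne]; [lia|].
  assert (Hin : i n < n) by (apply pointer_lt; lia).
  destruct (le_lt_dec (i n) m) as [Hle|Hgt].
  (* Here [i n] lies in the segment and is visible from [n], so by induction it equals [m]; but
     nothing points to a top. *)
  - exfalso. apply (not_pointer_to_top n); [lia|].
    replace (i n) with m; [exact Hm|]. symmetry.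
    apply (IH n); try lia. destruct n; [lia|apply i_view].
  - apply (IH (i n)); auto; lia.
Qed.

(* The positions from [a] to [b - 1] form a concatenation of segments from [i m]
   to [m] with [m] of maximal depth. *)
Inductive skip : nat -> nat -> Prop :=
| skip_refl a : skip a a
| skip_step m b : top m -> skip (S m) b -> skip (i m) b.

Definition kept (b : nat) : Prop := forall m, top m -> i m <> b.

(** The view from [S m] is [m] together with the view from [i m], so jumping over a segment adds
    only its top. *)
Lemma skip_view a b : skip a b -> forall k, view i b k -> view i a k \/ top k.
Proof.
  induction 1 as [a|m b Hm _ IH]; intros k Hk; [auto|].
  destruct (IH k Hk) as [H|H]; [|auto].
  destruct (view_S _ _ H) as [->|H']; auto.
Qed.

Lemma skip_cover a b : skip a b -> a <= b /\
  forall x, a <= x < b -> exists m, top m /\ m < b /\ i m <= x <= m.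
Proof.
  induction 1 as [a|m b Hm _ [IH1 IH2]]; [split; intros; lia|].
  assert (Hle := pointer_le m). split; [lia|]. intros x Hx.
  destruct (le_lt_dec x m) as [H|H].
  - exists m. repeat split; try apply Hm; lia.
  - apply IH2. lia.
Qed.

(** If a top [m] pointed to 0, only [m] would be visible from [S m], so [i (S m)] would be a top. *)
Lemma kept_0 : kept 0.
Proof.
  intros m Hm H0. apply (not_pointer_to_top (S m)); [lia|].
  destruct (view_S _ _ (i_view m)) as [->|H]; [exact Hm|].
  rewrite H0 in H. destruct (view_0 _ H).
Qed.

Variable R : nat -> nat -> Prop.
Hypothesis R_trans : forall a b c, R a b -> R b c -> R a c.
Hypothesis R_pointer : forall n, R (i n) (S n).

Lemma skip_R a b : skip a b -> a = b \/ R a b.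
Proof.
  induction 1 as [a|m b _ _ [IH|IH]]; [auto| |]; right.
  - rewrite <- IH. apply R_pointer.
  - eapply R_trans; [apply R_pointer|exact IH].
Qed.

(** If [a] is not kept, it starts a segment ending in a top [m], and [R a (S m)] lets the induction
    continue at [S m]. *)
Lemma skip_to_kept a : Acc (fun y x => R x y) a -> exists b, skip a b /\ kept b.
Proof.
  induction 1 as [a _ IH].
  destruct (classic (kept a)) as [H|H]; [exists a; split; [constructor|auto]|].
  apply not_all_ex_not in H. destruct H as [m H].
  apply imply_to_and in H. destruct H as [Hm H]. apply NNPP in H. subst a.
  destruct (IH (S m) (R_pointer m)) as (b & Hb & Hk).
  exists b. split; [|exact Hk]. now constructor.
Qed.

(* [e] enumerates the positions that remain after the deletion of all segments
   from [i m] to [m] with [m] of maximal depth; infinitely many remain, as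
   consecutive segments form a chain of [R]. *)
Lemma remove_top_segments :
  (exists c, forall k, R (c k) (c (S k))) \/
  exists e j : nat -> nat,
    (forall n, e (j n) = i (e n)) /\
    j 0 = 0 /\ (forall n, view j (S n) (j (S n))) /\
    (forall n, 0 < n -> 0 < e n /\ D (e n) < N) /\
    (forall n, R (e (j n)) (e (S n))).
Proof.
  destruct (classic (exists c, forall k, R (c k) (c (S k)))) as [|Hno]; [auto|].
  right. assert (Hacc := Acc_of_no_chain _ R Hno).
  destruct (functional_choice _ (fun a => skip_to_kept a (Hacc a))) as [g Hg].
  (* From [e n], move one position on and skip adjacent segments until a kept position is
     reached. *)
  set (e := fix e n := match n with 0 => 0 | S n => g (S (e n)) end).
  assert (Hskip : forall n, skip (S (e n)) (e (S n))) by (intro; apply Hg).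
  assert (Hkept : forall n, kept (e n)) by (intros [|n]; [apply kept_0|apply Hg]).
  assert (Hinc : forall n, e n < e (S n)).
  { intro n. assert (H := proj1 (skip_cover _ _ (Hskip n))). lia. }
  assert (Hpos : forall n, 0 < n -> 0 < e n).
  { intros [|n] H; [lia|]. assert (H1 := Hinc n). lia. }
  assert (Hmono : forall a b, a < b -> e a < e b).
  { intros a b H. induction H as [|b _ IH]; [apply Hinc|].
    assert (H1 := Hinc b). lia. }
  assert (Hcover : forall n x, x <= e n ->
    (exists k, k <= n /\ e k = x) \/
    exists m, top m /\ m < e n /\ i m <= x <= m).
  { induction n as [|n IH]; intros x Hx.
    - left. exists 0. cbn in *. split; lia.
    - destruct (le_lt_dec x (e n)) as [Hle|Hgt].
      + destruct (IH x Hle) as [(k & Hk & He)|(m & H1 & H2 & H3)].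
        * left. exists k. split; [lia|exact He].
        * right. exists m. specialize (Hinc n). repeat split; try apply H1; lia.
      + destruct (Nat.eq_dec x (e (S n))) as [->|Hne].
        * left. exists (S n). auto.
        * right. apply (skip_cover _ _ (Hskip n)). lia. }
  (* Pointers of surviving positions survive: inside a deleted segment, such a pointer could only be
     the top, by [top_hides]. *)
  assert (Hj : forall n, exists k, k <= n /\ e k = i (e n)).
  { intros [|n]; [exists 0; cbn; auto|].
    destruct (Hcover (S n) (i (e (S n))) (pointer_le _)) as [H|(m & H1 & H2 & H3)];
      [exact H|exfalso].
    assert (Hp := Hpos (S n) ltac:(lia)).
    apply (not_pointer_to_top (e (S n)) Hp).
    replace (i (e (S n))) with m; [exact H1|]. symmetry.
    apply (top_hides m H1 (e (S n)) H2); [|exact H3].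
    destruct (e (S n)); [lia|apply i_view]. }
  destruct (functional_choice _ Hj) as [j Hj'].
  assert (Hle : forall n, j n <= n) by (intro; apply Hj').
  assert (He : forall n, e (j n) = i (e n)) by (intro; apply Hj').
  (* A top [e n] would point to [e (j n)], which is kept and so starts no segment. *)
  assert (Htop : forall n, ~ top (e n)).
  { intros n H. apply (Hkept (j n) (e n) H). symmetry. apply He. }
  (* Compared with [S (e n)], position [e (S n)] sees at most additional tops, and no [e x] is a
     top. *)
  assert (Hview : forall n x, view i (e n) (e x) -> view j n x).
  { induction n as [n IH] using lt_wf_ind. intros x Hx.
    destruct n as [|n]; [destruct (view_0 _ Hx)|].
    destruct (skip_view _ _ (Hskip n) _ Hx) as [H|H]; [|destruct (Htop _ H)].
    destruct (view_S _ _ H) as [H'|H'].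
    - replace x with n; [constructor|].
      destruct (lt_eq_lt_dec x n) as [[Hlt|]|Hlt]; [|auto|];
        apply Hmono in Hlt; lia.
    - apply view_jump. apply IH; [specialize (Hle n); lia|].
      now rewrite He. }
  exists e, j. split; [exact He|]. split; [specialize (Hle 0); lia|].
  split; [|split].
  - intro n. apply Hview. rewrite He.
    assert (Hp := Hpos (S n) ltac:(lia)).
    destruct (e (S n)); [lia|apply i_view].
  - intros n Hn. split; [auto|].
    assert (H1 := D_max (e n) (Hpos n Hn)).
    destruct (Nat.eq_dec (D (e n)) N) as [H|H]; [|lia].
    destruct (Htop n). split; auto.
  - intro n. rewrite He.
    destruct (skip_R _ _ (Hskip n)) as [H|H].
    + rewrite <- H. apply R_pointer.
    + eapply R_trans; [apply R_pointer|exact H].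
Qed.

End Interaction.

(** Deleting the segments of maximal depth lowers the bound by one, with [D] and [R] pulled back
    along [e]; a chain found there maps back through [e]. At bound 0, position 1 has nothing of
    smaller depth to point to. *)
Lemma bounded_interaction_has_chain (N : nat) :
  forall (i D : nat -> nat) (R : nat -> nat -> Prop),
  i 0 = 0 -> (forall n, view i (S n) (i (S n))) ->
  (forall n, 0 < n -> D (i n) < D n) -> (forall n, 0 < n -> D n <= N) ->
  (forall a b c, R a b -> R b c -> R a c) -> (forall n, R (i n) (S n)) ->
  exists c : nat -> nat, forall k, R (c k) (c (S k)).
Proof.
  induction N as [|N IH]; intros i D R H0 Hv HD HN Ht HR.
  - exfalso. assert (H1 := HD 1). assert (H2 := HN 1). lia.
  - destruct (remove_top_segments i H0 Hv D (S N) HD HN R Ht HR)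
      as [H|(e & j & He & Hj0 & Hjv & Hpos & HRj)]; [exact H|].
    destruct (IH j (fun n => D (e n)) (fun a b => R (e a) (e b))) as [c Hc]; auto.
    + intros n Hn. rewrite He. apply HD, Hpos, Hn.
    + intros n Hn. destruct (Hpos n Hn). lia.
    + intros a b c. apply Ht.
    + exists (fun k => e (c k)). exact Hc.
Qed.

(** A view depends only on pointers at smaller positions. This links the pointer list of a state
    with the pointers of a whole infinite debate. *)
Lemma view_eq_below (L : nat) (i j : nat -> nat) :
  (forall m, m < L -> i m = j m /\ i m <= m) ->
  forall n k, view i n k -> n <= L -> view j n k.
Proof.
  intros H n k Hv. induction Hv as [n|n k _ IH]; intro Hn; [constructor|].
  destruct (H n Hn) as [H1 H2].
  apply view_jump. rewrite <- H1. apply IH. lia.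
Qed.

(** * Sequences and plays *)

Lemma nth_error_initial (X : Type) (q p : list X) k a :
  initial q p -> nth_error q k = Some a -> nth_error p k = Some a.
Proof.
  intros [r ->] H. rewrite nth_error_app1; [exact H|].
  apply nth_error_Some. congruence.
Qed.

Lemma initial_length (X : Type) (q p : list X) : initial q p -> length q <= length p.
Proof. intros [r ->]. rewrite length_app. lia. Qed.

Lemma initial_trans (X : Type) (p q r : list X) :
  initial p q -> initial q r -> initial p r.
Proof. intros [a ->] [b ->]. exists (a ++ b). now rewrite app_assoc. Qed.

Lemma proper_initial_trans (X : Type) (p q r : list X) :
  proper_initial p q -> proper_initial q r -> proper_initial p r.
Proof.
  intros (a & s & ->) (b & t & ->). exists a, (s ++ b :: t).
  now rewrite <- app_assoc.
Qed.

Lemma initial_seq_fin (X : Type) (q p : list X) :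
  initial_seq (fin q) (fin p) -> initial q p.
Proof.
  revert p. induction q as [|a q IH]; intros p H; [exists p; reflexivity|].
  assert (H0 := H 0 a eq_refl). destruct p as [|b p]; [discriminate|].
  cbn in H0. injection H0 as ->.
  destruct (IH p) as [r ->]; [|exists r; reflexivity].
  intros k c Hc. exact (H (S k) c Hc).
Qed.

Lemma initial_next (X : Type) (q p : list X) b :
  initial q p -> nth_error p (length q) = Some b -> exists r, p = q ++ b :: r.
Proof.
  intros [r ->] H. rewrite nth_error_app2, Nat.sub_diag in H by lia.
  destruct r as [|a r]; [discriminate|]. injection H as ->. exists r. reflexivity.
Qed.

Lemma initial_seq_inf (X : Type) (l : list X) (u : nat -> X) :
  initial_seq (fin l) (inf u) -> l = take u (length l).
Proof.
  intro H. apply nth_error_ext. intro k. unfold take.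
  rewrite nth_error_map, nth_error_seq.
  destruct (Nat.ltb_spec k (length l)) as [Hk|Hk].
  - destruct (nth_error l k) as [a|] eqn:Ha.
    + cbn. symmetry. exact (H k a Ha).
    + apply nth_error_None in Ha. lia.
  - cbn. apply nth_error_None. lia.
Qed.

Lemma take_split (X : Type) (u : nat -> X) n m : n < m ->
  exists r, take u m = take u n ++ u n :: r.
Proof.
  intro H. replace m with (n + S (m - S n)) by lia. unfold take.
  rewrite seq_app, map_app. eexists. reflexivity.
Qed.

Lemma chain_limit (X : Type) (x0 : X) (L : nat -> list X) :
  (forall k, proper_initial (L k) (L (S k))) ->
  exists u, forall n, exists k r, L k = take u n ++ u n :: r.
Proof.
  intro HL.
  assert (Hlen : forall k, k <= length (L k)).
  { induction k as [|k IH]; [lia|]. destruct (HL k) as (a & r & ->).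
    rewrite length_app. cbn. lia. }
  assert (Hle : forall a b, a <= b -> initial (L a) (L b)).
  { intros a b H. induction H as [|b _ IH]; [exists []; now rewrite app_nil_r|].
    eapply initial_trans; [exact IH|]. destruct (HL b) as (c & r & Hc).
    exists (c :: r). exact Hc. }
  (* Lengths grow at every step, so [L (S n)] has an entry [n] and the default [x0] is never
     read. *)
  set (u := fun n => nth n (L (S n)) x0).
  exists u. intro n. exists (S n).
  assert (Hu : initial_seq (fin (L (S n))) (inf u)).
  { intros k a Ha. cbn. f_equal. cbn in Ha.
    assert (Hk : nth_error (L (S k)) k = Some (u k)).
    { apply nth_error_nth'. specialize (Hlen (S k)). lia. }
    destruct (Nat.le_ge_cases k n) as [H|H].
    - apply nth_error_initial with (p := L (S n)) in Hk; [congruence|].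
      apply Hle. lia.
    - apply nth_error_initial with (p := L (S k)) in Ha; [congruence|].
      apply Hle. lia. }
  destruct (take_split _ u n (length (L (S n)))) as [r Hr].
  { specialize (Hlen (S n)). lia. }
  exists r. rewrite <- Hr. now apply initial_seq_inf.
Qed.

Lemma legal_play_prefix (X : Type) (E A : list X -> X -> Prop) p :
  legal_play E A p -> forall q a r, p = q ++ a :: r ->
  legal_play E A q /\ (E q a \/ A q a).
Proof.
  induction 1 as [|p b Hp IH Hb]; intros q a r Hq.
  - destruct q; discriminate.
  - destruct r as [|c r _] using rev_ind.
    + apply app_inj_tail in Hq. destruct Hq as [-> ->]. auto.
    + rewrite app_comm_cons, app_assoc in Hq. apply app_inj_tail in Hq.
      apply (IH q a r). apply Hq.
Qed.

(** Where [winning] says that the limit of the chain fails, some [L k] passes with the same next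
    move: the position is not won, and the move obeys [f] and is legal. *)
Lemma winning_no_chain (X : Type) (G : game X) (f : list X -> X) :
  winning G f -> forall L, (forall k, strategy_tree G f (L k)) ->
  ~ forall k, proper_initial (L k) (L (S k)).
Proof.
  intros Hw L HT HL.
  destruct (chain_limit _ (f []) L HL) as [u Hu].
  destruct (Hw u) as (n & Hp & Hn).
  destruct (Hu n) as (k & r & Hk).
  destruct (HT k) as [Hplay HTk].
  destruct (HTk _ _ _ Hk) as [Hnw Hf].
  destruct (legal_play_prefix _ _ _ _ Hplay _ _ _ Hk) as [_ Hleg].
  destruct Hn as [H|[[H1 H2]|[H1 H2]]]; [auto|auto|].
  destruct Hleg as [H|H]; [|auto].
  apply (dom_disjoint (g := G) (p := take u n)). split; [exists (u n)|]; auto.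
Qed.

Lemma strategy_tree_snoc (X : Type) (G : game X) (f : list X -> X) p a :
  strategy_tree G f p -> ~ win G p -> legal G p a ->
  (dom (eloisa G) p -> a = f p) -> strategy_tree G f (p ++ [a]).
Proof.
  intros [Hp HT] Hw Ha Hf. split; [constructor; auto|].
  intros q b r H. destruct r as [|c r _] using rev_ind.
  - apply app_inj_tail in H. destruct H as [-> ->]. auto.
  - rewrite app_comm_cons, app_assoc in H. apply app_inj_tail in H.
    apply (HT q b r). apply H.
Qed.

(** * Debates are finite *)

Lemma bounded_nondecreasing_stationary (z : nat -> nat) (B : nat) :
  (forall s, z s <= z (S s)) -> (forall s, z s <= B) ->
  exists s0, forall s, s0 <= s -> z s = z s0.
Proof.
  intros Hz HB.
  assert (Hle : forall a b, a <= b -> z a <= z b).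
  { intros a b H. induction H as [|b _ IH]; [lia|]. specialize (Hz b). lia. }
  cut (forall n s, B - z s <= n -> exists s0, forall s, s0 <= s -> z s = z s0).
  { intro H. exact (H (B - z 0) 0 (Nat.le_refl _)). }
  induction n as [|n IH]; intros s Hs.
  - exists s. intros t Ht. specialize (Hle s t Ht).
    assert (H1 := HB t). lia.
  - destruct (classic (exists t, s <= t /\ z s < z t)) as [(t & H1 & H2)|H].
    + apply (IH t). lia.
    + exists s. intros t Ht. specialize (Hle s t Ht).
      destruct (Nat.eq_dec (z t) (z s)); [auto|].
      destruct H. exists t. lia.
Qed.

Section Finiteness.

Variables (At : Type) (S : Ensemble (literal At)) (Gamma : Ensemble (formula At)).
Variables (phi : formula At) (f0 f1 : list (move At) -> move At).
Hypothesis hdepth : finite_depth phi.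
Hypothesis h0 : winning (tait_game S (Add (formula At) Gamma (dual phi))) f0.
Hypothesis h1 : winning (tait_game S (Add (formula At) Gamma phi)) f1.

Lemma side_winning n : winning (side_game S Gamma phi n) (side_strategy f0 f1 n).
Proof. unfold side_game, side_strategy. now destruct (Nat.even n). Qed.

Lemma side_even n m : Nat.even n = Nat.even m ->
  side_game S Gamma phi n = side_game S Gamma phi m /\
  side_strategy f0 f1 n = side_strategy f0 f1 m.
Proof. unfold side_game, side_strategy. now intros ->. Qed.

Lemma st_play_size (d : state phi) : st_play d (st_size d) = leading d.
Proof.
  unfold st_play, st_size. rewrite app_nth2; rewrite length_map; [|lia].
  now rewrite Nat.sub_diag.
Qed.

(** Its components are the defaults of the accessors, so plays, nodes and pointers are read off one
    entry of [triples]. *)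
Definition triple_default : list (move At) * tree phi * nat := ([], tree_root phi, 0).

Lemma st_play_triple (d : state phi) m : m < st_size d ->
  st_play d m = fst (fst (nth m (triples d) triple_default)).
Proof.
  unfold st_play, st_size. intro H. rewrite app_nth1; [|now rewrite length_map].
  exact (map_nth (fun t => fst (fst t)) (triples d) triple_default m).
Qed.

Lemma st_node_triple (d : state phi) m :
  st_node d m = snd (fst (nth m (triples d) triple_default)).
Proof. exact (map_nth (fun t => snd (fst t)) (triples d) triple_default m). Qed.

Lemma st_pointer_triple (d : state phi) m :
  st_pointer d m = snd (nth m (triples d) triple_default).
Proof. exact (map_nth snd (triples d) triple_default m). Qed.

(** * The limit of an infinite debate *)

Variable v : nat -> state phi.
Hypothesis v_ok : forall s, state_ok S f0 f1 Gamma (v s).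
Hypothesis v_ext : forall s, v (s + 1) <> v s /\ state_extends (v s) (v (s + 1)).

Lemma triples_extend a b : a <= b ->
  exists ts, triples (v b) = triples (v a) ++ ts.
Proof.
  intro H. induction H as [|b _ [ts IH]]; [exists []; now rewrite app_nil_r|].
  destruct (v_ext b) as [_ [[us Hu] _]]. rewrite Nat.add_1_r in Hu.
  exists (ts ++ us). now rewrite Hu, IH, app_assoc.
Qed.

Lemma nth_triples_stable a b m : m < st_size (v a) -> m < st_size (v b) ->
  nth m (triples (v a)) triple_default = nth m (triples (v b)) triple_default.
Proof.
  unfold st_size. intros Ha Hb.
  destruct (Nat.le_ge_cases a b) as [H|H];
    destruct (triples_extend _ _ H) as [ts E]; rewrite E, app_nth1; auto.
Qed.

(** Once the sizes are constant, consecutive states differ only in their leading plays, which then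
    grow properly forever within one strategy tree. *)
Lemma sizes_unbounded m : exists s, m < st_size (v s).
Proof.
  apply NNPP. intro Hno.
  destruct (bounded_nondecreasing_stationary (fun s => st_size (v s)) m)
    as [s0 Hs0].
  { intro s. destruct (triples_extend s (Datatypes.S s)) as [ts E]; [lia|].
    unfold st_size. rewrite E, length_app. lia. }
  { intro s. destruct (le_lt_dec (st_size (v s)) m); [auto|].
    destruct Hno. exists s. auto. }
  apply (winning_no_chain _ _ _ (side_winning (st_size (v s0)))
           (fun k => leading (v (s0 + k)))).
  - intro k. rewrite <- st_play_size, (Hs0 (s0 + k)) by lia.
    destruct (v_ok (s0 + k)) as [H _]. apply H. rewrite (Hs0 (s0 + k)); lia.
  - intro k. replace (s0 + Datatypes.S k) with (s0 + k + 1) by lia.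
    set (s := s0 + k).
    destruct (v_ext s) as [Hne [[ts Hts] Hini]].
    assert (Hsz : st_size (v (s + 1)) = st_size (v s)).
    { rewrite (Hs0 (s + 1)), (Hs0 s); auto; unfold s; lia. }
    rewrite <- Hsz, st_play_size in Hini. destruct Hini as [r Hr].
    destruct r as [|a r]; [|exists a, r; exact Hr].
    destruct Hne. unfold st_size in Hsz. rewrite Hts, length_app in Hsz.
    destruct ts; [|cbn in Hsz; lia].
    rewrite app_nil_r in Hts, Hr.
    destruct (v (s + 1)), (v s). cbn in *. congruence.
Qed.

Lemma no_infinite_debate : False.
Proof.
  destruct hdepth as [N HN].
  destruct (functional_choice _ sizes_unbounded) as [b Hb].
  (* [b m] is a stage at which triple [m] is present; [t] lists the triples of the limit. *)
  set (t := fun m => nth m (triples (v (b m))) triple_default).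
  assert (Ht : forall s m, m < st_size (v s) ->
            nth m (triples (v s)) triple_default = t m)
    by (intros; apply nth_triples_stable; auto).
  set (P := fun m => fst (fst (t m))).
  set (D := fun m => dt (snd (fst (t m)))).
  set (i := fun m => snd (t m)).
  assert (HP : forall s m, m < st_size (v s) -> st_play (v s) m = P m).
  { intros s m H. rewrite st_play_triple, Ht; auto. }
  assert (HD : forall s m, m < st_size (v s) -> dt (st_node (v s) m) = D m).
  { intros s m H. rewrite st_node_triple, Ht; auto. }
  assert (Hi : forall s m, m < st_size (v s) -> st_pointer (v s) m = i m).
  { intros s m H. rewrite st_pointer_triple, Ht; auto. }
  assert (Hlen : forall s, length (st_pointers (v s)) = st_size (v s))
    by (intro; apply length_map).
  assert (Hi0 : i 0 = 0).
  { destruct (v_ok (b 0)) as (_ & [H _] & _).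
    rewrite <- (Hi (b 0)); auto. apply H. rewrite Hlen. auto. }
  assert (Hilt : forall n, i (Datatypes.S n) < Datatypes.S n).
  { intro n. destruct (v_ok (b (Datatypes.S n))) as (_ & [_ H] & _).
    rewrite <- (Hi (b (Datatypes.S n))); auto. apply H. rewrite Hlen. auto. }
  assert (Hview : forall n, view i (Datatypes.S n) (i (Datatypes.S n))).
  { intro n. set (s := b (Datatypes.S n)).
    assert (Hs : Datatypes.S n < st_size (v s)) by apply Hb.
    destruct (v_ok s) as (_ & [_ H] & _).
    rewrite <- (Hi s) at 1; auto.
    apply view_eq_below with (L := st_size (v s)) (i := st_pointer (v s));
      [|apply H; rewrite Hlen; auto|lia].
    intros m Hm. split; [now apply Hi|]. rewrite Hi; auto.
    destruct m; [lia|]. specialize (Hilt m). lia. }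
  assert (Hstep : forall m, 0 < m ->
            proper_initial (P (i m)) (P (m + 1)) /\ D (i m) < D m).
  { intros m Hm. assert (Hs := Hb (m + 1)). set (s := b (m + 1)) in *.
    assert (Him : i m < m) by (destruct m; [lia|auto]).
    destruct (v_ok s) as (_ & _ & H).
    destruct (H m) as [H1 H2]; [lia|].
    rewrite Hi in H1, H2 by lia.
    rewrite !HP in H1 by lia. rewrite !HD in H2 by lia. auto. }
  assert (HT : forall m, strategy_tree (side_game S Gamma phi m)
                           (side_strategy f0 f1 m) (P m)).
  { intro m. assert (Hs := Hb m). rewrite <- (HP (b m)); auto.
    destruct (v_ok (b m)) as (H & _ & _). apply H. lia. }
  (* The clause [a = 0] covers the pair 0, 1, whose plays belong to different side games. As
     [a < c], a chain leaves 0 after one step. *)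
  destruct (bounded_interaction_has_chain N i D
    (fun a c => a < c /\ (a = 0 \/ Nat.even a = Nat.even c /\ proper_initial (P a) (P c))))
    as [c Hc]; auto.
  - intros n Hn. apply Hstep, Hn.
  - intros n _. apply HN.
  - intros x y z [H2 H3] [H4 H5]. split; [lia|].
    destruct H3 as [H3|[H3 H3']]; [auto|].
    destruct H5 as [H5|[H5 H5']]; [lia|]. right.
    split; [congruence|]. eapply proper_initial_trans; eauto.
  - intros [|n]; [rewrite Hi0; split; auto|].
    split; [specialize (Hilt n); lia|]. right.
    split; [apply pointer_parity; auto; lia|].
    replace (Datatypes.S (Datatypes.S n)) with (Datatypes.S n + 1) by lia.
    apply Hstep. lia.
  (* From index 1 on, the chain is positive, so its plays all belong to the side game of [c 1] and
     extend one another. *)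
  - assert (Hc0 : forall k, 0 < c (Datatypes.S k)).
    { intro k. destruct (Hc k) as [H _]. lia. }
    assert (Hev : forall k, Nat.even (c 1) = Nat.even (c (Datatypes.S k)) /\
              proper_initial (P (c (Datatypes.S k))) (P (c (Datatypes.S (Datatypes.S k))))).
    { induction k as [|k [IH _]].
      - destruct (Hc 1) as [_ [H|[_ H]]]; [|auto]. specialize (Hc0 0). lia.
      - destruct (Hc (Datatypes.S k)) as [_ [H|[H _]]];
          [specialize (Hc0 k); lia|].
        destruct (Hc (Datatypes.S (Datatypes.S k))) as [_ [H'|[_ H']]];
          [specialize (Hc0 (Datatypes.S k)); lia|].
        split; [congruence|auto]. }
    apply (winning_no_chain _ _ _ (side_winning (c 1))
             (fun k => P (c (Datatypes.S k)))).
    + intro k. destruct (side_even _ _ (proj1 (Hev k))) as [-> ->]. apply HT.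
    + intro k. apply Hev.
Qed.

End Finiteness.

(** * The cut strategy *)

Section Cut.

Variables (At : Type) (S : Ensemble (literal At)) (Gamma : Ensemble (formula At)).
Variables (phi : formula At) (f0 f1 : list (move At) -> move At).
Hypothesis hdepth : finite_depth phi.
Hypothesis h0 : winning (tait_game S (Add (formula At) Gamma (dual phi))) f0.
Hypothesis h1 : winning (tait_game S (Add (formula At) Gamma phi)) f1.
Variable d : debate_map phi.
Hypothesis hd : debate S f0 f1 Gamma d.
Hypothesis hrec : records_moves S f0 f1 Gamma d.

Lemma debate_finite p : exists rs ds ps, d p = fin (rs ++ [(ds, ps)]).
Proof.
  destruct hd as [Hq _]. destruct (Hq p) as ([r0 Hne] & Hok & Hext).
  destruct (d p) as [l|u].
  - destruct l as [|[ds ps] rs _] using rev_ind; [discriminate|].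
    exists rs, ds, ps. reflexivity.
  - exfalso.
    apply (no_infinite_debate At S Gamma phi f0 f1 hdepth h0 h1 (fun s => fst (u s))).
    + intro s. destruct (Hok s (fst (u s)) (snd (u s))) as [H _]; [|exact H].
      cbn. f_equal. apply surjective_pairing.
    + intro s.
      destruct (Hext s (fst (u s)) (snd (u s)) (fst (u (s + 1))) (snd (u (s + 1))))
        as (H1 & H2 & _); auto; cbn; f_equal; apply surjective_pairing.
Qed.

Lemma debate_last_round p : exists rs ds ps,
  d p = fin (rs ++ [(ds, ps)]) /\ entry (d p) (length rs) = Some (ds, ps) /\
  play (tait_game S Gamma) ps /\ initial_seq (fin ps) p /\
  final_round S f0 f1 Gamma p ds ps.
Proof.
  destruct (debate_finite p) as (rs & ds & ps & E).
  exists rs, ds, ps. destruct hd as (Hq & _ & Hnl).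
  assert (He : entry (d p) (length rs) = Some (ds, ps)).
  { rewrite E. cbn. rewrite nth_error_app2, Nat.sub_diag; auto. }
  assert (Hl : has_length (d p) (length rs + 1)).
  { rewrite E. eexists. split; [reflexivity|]. now rewrite length_app. }
  destruct (Hq p) as (_ & Hok & _). destruct (Hok _ _ _ He) as (_ & H1 & H2).
  repeat split; auto. now apply (Hnl p _ _ _ He).
Qed.

Variable f : list (move At) -> move At.
Hypothesis hf : is_cut f0 f1 d f.

Notation G := (tait_game S Gamma).

(* The debates of [ps] and [p] end in the same round: if the former stopped
   earlier, the move proposed there would be recorded in the next round of the
   latter, hence would be the next move of [ps]. *)
Lemma cut_at_last_round p rs ds ps :
  d p = fin (rs ++ [(ds, ps)]) -> initial_seq (fin ps) p ->
  play G ps -> dom (eloisa G) ps -> (forall q, initial q ps -> ~ win G q) ->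
  f ps = proposed_move f0 f1 ds.
Proof.
  intros E Hps Hplay Hdom Hnw. destruct hd as (Hq & Hmon & _).
  destruct (debate_last_round (fin ps))
    as (rs' & ds' & ps' & E' & He' & Hplay' & Hini & Hfin).
  rewrite (hf _ _ _ _ E').
  assert (Hini' := initial_seq_fin _ _ _ Hini).
  (* By monotonicity, the last round on [ps] also occurs in the debate on [p]. *)
  assert (Hp := Hmon _ _ Hps _ _ He').
  destruct (lt_dec (length rs') (length rs)) as [Hlt|Hge].
  - exfalso.
    destruct (nth_error (rs ++ [(ds, ps)]) (length rs' + 1)) as [[ds2 ps2]|] eqn:E2;
      [|apply nth_error_None in E2; rewrite length_app in E2; cbn in E2; lia].
    assert (Hlast : initial ps2 ps).
    { destruct (Hq p) as (_ & _ & Hext).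
      assert (Hall : forall k dk pk, length rs' + 1 + k <= length rs ->
        entry (d p) (length rs' + 1 + k) = Some (dk, pk) -> initial ps2 pk).
      { induction k as [|k IH]; intros dk pk Hk Hek.
        - rewrite E, Nat.add_0_r in Hek. cbn in Hek. rewrite E2 in Hek.
          injection Hek as <- <-. exists []. now rewrite app_nil_r.
        - destruct (entry (d p) (length rs' + 1 + k)) as [[dk' pk']|] eqn:Ek.
          + eapply initial_trans; [apply (IH _ _ ltac:(lia) eq_refl)|].
            apply (Hext _ _ _ dk pk Ek). rewrite <- Hek. f_equal. lia.
          + rewrite E in Ek. cbn in Ek. apply nth_error_None in Ek.
            rewrite length_app in Ek. cbn in Ek. lia. }
      apply (Hall (length rs - (length rs' + 1)) ds); [lia|].
      replace (length rs' + 1 + _) with (length rs) by lia.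
      rewrite E. cbn. rewrite nth_error_app2, Nat.sub_diag; auto. }
    assert (Hrec : eloisa_round S f0 f1 Gamma ds' ps' ->
              initial (ps' ++ [proposed_move f0 f1 ds']) ps).
    { intro Hround. eapply initial_trans; [|exact Hlast].
      apply (hrec p (length rs') ds' ps' ds2 ps2); auto. rewrite E. exact E2. }
    (* No reason for stopping at [ps'] applies: no initial segment of [ps] is won, the recorded
       proposal is the next move of [ps], and the moves of [ps] are legal. *)
    destruct Hfin as [Hw|[[Hr Hor]|[Ha Hor]]].
    + exact (Hnw _ Hini' Hw).
    + specialize (Hrec Hr). destruct Hor as [Heq|(b & Hb & Hne)].
      * injection Heq as <-. apply initial_length in Hrec.
        rewrite length_app in Hrec. cbn in Hrec. lia.
      * apply Hne. cbn in Hb. destruct Hrec as [r Hr'].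
        rewrite Hr', <- app_assoc, nth_error_app2, Nat.sub_diag in Hb by lia.
        cbn in Hb. congruence.
    + destruct Hor as [Heq|(b & Hb & Hne)].
      * injection Heq as <-. exact (dom_disjoint (conj Hdom Ha)).
      * apply Hne. destruct (initial_next _ _ _ _ Hini' Hb) as [r Hl].
        apply (legal_play_prefix _ _ _ _ Hplay _ _ _ Hl).
  (* Now the lengths agree, so the two final rounds coincide. *)
  - rewrite E in Hp. cbn in Hp.
    assert (Hlt : length rs' < length (rs ++ [(ds, ps)])).
    { apply nth_error_Some. congruence. }
    rewrite length_app in Hlt. cbn in Hlt.
    replace (length rs') with (length rs) in Hp by lia.
    rewrite nth_error_app2, Nat.sub_diag in Hp by lia. cbn in Hp. congruence.
Qed.

End Cut.

(** * Legality and winning for the cut strategy *)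

Theorem mainTheorem15 (At : Type)
  (S : Ensemble (literal At)) (hS : choice_of_literals S)
  (Gamma : Ensemble (formula At)) (hGamma : Finite (formula At) Gamma)
  (phi : formula At) (hor : is_or phi = true) (hdepth : finite_depth phi)
  (f0 f1 : list (move At) -> move At)
  (d : debate_map phi)
  (hd : debate S f0 f1 Gamma d) (hrec : records_moves S f0 f1 Gamma d)
  (h0 : winning_strategy (tait_game S (Add (formula At) Gamma (dual phi))) f0)
  (h1 : winning_strategy (tait_game S (Add (formula At) Gamma phi)) f1)
  (f : list (move At) -> move At) (hf : is_cut f0 f1 d f) :
  winning_strategy (tait_game S Gamma) f.
Proof.
  destruct h0 as [_ w0], h1 as [_ w1].
  split.
  - intros p Hp. split; [|split].
    + intros Hw q (a & r & Hq) [_ Hq']. exact (proj1 (Hq' _ _ _ Hq) Hw).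
    + intros Hnw Hdom.
      assert (Hnwin : forall q, initial q p -> ~ win (tait_game S Gamma) q).
      { intros q [[|a r] Hq].
        - rewrite app_nil_r in Hq. now subst q.
        - apply (proj2 Hp _ _ _ Hq). }
      destruct (debate_last_round At S Gamma phi f0 f1 hdepth w0 w1 d hd (fin p))
        as (rs & ds & ps & E & _ & Hplay & Hini & Hfin).
      assert (Hini' := initial_seq_fin _ _ _ Hini).
      assert (Hleg : legal (tait_game S Gamma) p (f p)).
      { destruct Hfin as [Hw|[[Hr [Heq|(b & Hb & Hne)]]|[Ha [Heq|(b & Hb & Hne)]]]].
        - destruct (Hnwin _ Hini' Hw).
        - rewrite (hf _ _ _ _ E). injection Heq as ->. apply Hr.
        (* The debate stopped because [p] departs from the proposal at [ps]; but [p] follows [f],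
           and [f ps] is that proposal. *)
        - exfalso. destruct (initial_next _ _ _ _ Hini' Hb) as [r Hl].
          destruct (proj2 Hp _ _ _ Hl) as [_ Hfb]. apply Hne.
          rewrite (Hfb (proj1 Hr)). symmetry.
          apply (cut_at_last_round At S Gamma phi f0 f1 hdepth w0 w1 d hd hrec f hf
                   (fin p) rs); auto; [apply Hr|].
          intros q Hq. apply Hnwin. eapply initial_trans; eauto.
        - injection Heq as <-. destruct (dom_disjoint (conj Hdom Ha)).
        - exfalso. destruct (initial_next _ _ _ _ Hini' Hb) as [r Hl]. apply Hne.
          apply (legal_play_prefix _ _ _ _ (proj1 Hp) _ _ _ Hl). }
      exists (f p). split; [now apply strategy_tree_snoc|].
      intros a [_ Ha]. symmetry. now apply (Ha p a []).
    + intros Hnw Hdom a Ha. apply strategy_tree_snoc; auto; [now right|].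
      intro He. destruct (dom_disjoint (conj He Hdom)).
  - intro u.
    destruct (debate_last_round At S Gamma phi f0 f1 hdepth w0 w1 d hd (inf u))
      as (rs & ds & ps & E & _ & Hplay & Hini & Hfin).
    assert (Hps := initial_seq_inf _ _ _ Hini).
    (* A win within [ps] settles the claim; otherwise no initial segment of [ps] is won, as
       [cut_at_last_round] requires. *)
    destruct (classic (exists q, initial q ps /\ win (tait_game S Gamma) q))
      as [(q & [r Hq] & Hw)|Hnw].
    { exists (length q). replace (take u (length q)) with q.
      - split; [apply (win_play Hw)|now left].
      - apply initial_seq_inf. intros k a Ha. apply Hini.
        apply (nth_error_initial _ q); [now exists r|exact Ha]. }
    exists (length ps). rewrite <- Hps. split; [exact Hplay|].
    destruct Hfin as [Hw|[[Hr [Heq|(b & Hb & Hne)]]|[Ha [Heq|(b & Hb & Hne)]]]];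
      try discriminate.
    + now left.
    (* Here [u] departs from the proposal at [ps], which is the move of the cut strategy. *)
    + right. left. injection Hb as <-. split; [apply Hr|].
      rewrite (cut_at_last_round At S Gamma phi f0 f1 hdepth w0 w1 d hd hrec f hf
                 (inf u) rs ds ps); auto; [apply Hr|].
      intros q Hq Hw. apply Hnw. now exists q.
    + right. right. injection Hb as <-. split; [exact Ha|].
      intro H. apply Hne. now right.
Qed.
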